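(* Let $X$ be a smooth hypersurface of degree $d\ge 3$ in $\mathbb{P}^N$. Then $X$ has at most finitely many star points.
   Context: The base field is $\mathbb{C}$ and $N\ge 2$. For a smooth point $P$ of a hypersurface $X\subset\mathbb{P}^N$ of degree $d$, $T_P(X)$ denotes the embedded tangent hyperplane of $X$ at $P$; $P$ is a star point of $X$ if the scheme $T_P(X)\cap X$ has multiplicity $d$ at $P$ (for $N\ge3$: if it is a cone of degree $d$ with vertex $P$ in $T_P(X)$). *)

(* Defs.v *)
From HB Require Import structures.
From mathcomp Require Import all_boot all_algebra.
From mathcomp Require Import classical_sets cardinality reals complex mpoly.

Set Implicit Arguments.
Unset Strict Implicit.
Unset Printing Implicit Defensive.

Import GRing.Theory.
Local Open Scope ring_scope.
Local Open Scope quotient_scope.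

(* P^N as the quotient of K^(N+1) \ {0} by proportionality; two nonzero row
   vectors are proportional iff they have the same row space.                *)
Section ProjectiveSpace.
Variables (K : fieldType) (N : nat).

Definition nonzero_vec := {v : 'rV[K]_N.+1 | v != 0}.

Definition proportional : rel nonzero_vec :=
  fun u v => (val u == val v)%MS.

Lemma proportional_equiv : equiv_class_of proportional.
Proof.
split=> [u|u v|v u w].
- by rewrite /proportional submx_refl.
- by rewrite /proportional andbC.
- rewrite /proportional => /andP[uv vu] /andP[vw wv].
  by rewrite (submx_trans uv vw) (submx_trans wv vu).
Qed.

Canonical proportional_rel := EquivRelPack proportional_equiv.

Definition proj_space := {eq_quot proportional_rel}.

Definition hcoord (P : proj_space) : 'rV[K]_N.+1 := val (repr P).

Lemma proportionalP (u v : nonzero_vec) :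
  reflect (exists2 c : K, c != 0 & val v = c *: val u)
          (\pi_proj_space u == \pi_proj_space v).
Proof.
rewrite eqmodE /= /proportional.
apply: (iffP andP) => [[_ /sub_rVP[c vE]]|[c c0 vE]].
- exists c => //; apply/eqP => c0.
  by have /eqP[] := valP v; rewrite vE c0 scale0r.
- rewrite /= vE; split; last exact: scalemx_sub.
  by apply/sub_rVP; exists c^-1; rewrite scalerA mulVf ?scale1r.
Qed.

End ProjectiveSpace.

(* A hypersurface of P^N is given by its equation F, a nonzero form of degree
   d; every notion below depends on the class of proportional vectors only,
   since F is homogeneous.                                                   *)
Section Hypersurface.
Variables (K : fieldType) (N : nat).
Implicit Types (F : {mpoly K[N.+1]}) (v : 'rV[K]_N.+1) (P : proj_space K N).

Definition hypersurface (d : nat) F : Prop := F \is d.-homog /\ F != 0.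

Definition on_hypersurface F P : Prop := F.@[fun i => hcoord P 0 i] = 0.

Definition gradient F v : 'cV[K]_N.+1 :=
  \col_i (F^`M(i)).@[fun j => v 0 j].

Definition smooth_at F P : Prop :=
  on_hypersurface F P /\ gradient F (hcoord P) != 0.

Definition smooth_hypersurface F : Prop :=
  forall P, on_hypersurface F P -> smooth_at F P.

(* The row space of this matrix is the linear space of all w with
   \sum_i w_i (dF/dx_i)(P) = 0, whose projectivization is T_P(X).            *)
Definition tangent_hyperplane F P : 'M[K]_N.+1 :=
  kermx (gradient F (hcoord P)).

(* If v, b_1, ..., b_n is a basis of a linear space L, with b_i = row i B, then
   (y_1, ..., y_n) |-> [v + \sum_i y_i b_i] is an affine chart of P(L) around
   [v], mapping 0 to [v], and this is the equation of V(F) in that chart.    *)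
Definition local_equation F v (n : nat) (B : 'M[K]_(n, N.+1)) : {mpoly K[n]} :=
  F \mPo [tuple (v 0 j)%:MP + \sum_(i < n) B i j *: 'X_i | j < N.+1].

(* g lies in m^e but not in m^(e+1), where m is the ideal of the origin; in
   particular g is nonzero.                                                  *)
Definition vanishing_order (n : nat) (g : {mpoly K[n]}) (e : nat) : Prop :=
  (forall m, m \in msupp g -> (e <= mdeg m)%N) /\
  (exists2 m, m \in msupp g & mdeg m = e).

(* The multiplicity at P of the hypersurface P(L) :&: V(F) of the linear
   subspace P(L) is the order of a local equation; it does not depend on the
   chart.                                                                    *)
Definition has_multiplicity F (k : nat) (L : 'M[K]_(k, N.+1)) P (e : nat)
    : Prop :=
  exists (n : nat) (B : 'M[K]_(n, N.+1)),
    [/\ row_free (col_mx (hcoord P) B),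
        (col_mx (hcoord P) B == L)%MS
      & vanishing_order (local_equation F (hcoord P) B) e].

Definition star_point (d : nat) F P : Prop :=
  smooth_at F P /\ has_multiplicity F (tangent_hyperplane F P) P d.

End Hypersurface.

(* Main.v *)
Require Import Defs.
From HB Require Import structures.
From mathcomp Require Import all_boot all_algebra.
From mathcomp Require Import boolp classical_sets functions cardinality filter.
From mathcomp Require Import reals complex mpoly.
From mathcomp Require Import ring.

Set Implicit Arguments.
Unset Strict Implicit.
Unset Printing Implicit Defensive.

Import GRing.Theory.
Local Open Scope ring_scope.
Local Open Scope classical_set_scope.

(** At a star point P of a hypersurface F = 0 of degree at least 3 the
    restriction of F to the tangent hyperplane has order at least 3 at P, so the
    Hessian of F at P vanishes on that hyperplane: the differential of the Gauss
    map, which sends a point to its gradient up to scalars, is zero at P.  The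
    Gauss map of a smooth hypersurface is finite, so in characteristic 0 its
    differential cannot vanish along a curve; a closed set made of such points
    is therefore finite.

    The curve is replaced by a generic point.  If there were infinitely many
    star points, an ultrapower of the base field K would be a field L with a
    point v over L that satisfies every equation shared by the star points and
    is not proportional to a point over K (generic_point).  Two facts about the
    extension L of K give the contradiction.

    - Derivations.  If y in L is not in K, it is transcendental over K, and there
      is a K-derivation with values in L, defined at least on y and the
      coordinates of v, which maps y to 1 (tangent_vector).  Take for y a ratio
      of two partial derivatives of F at v: the vanishing of the Hessian on the
      tangent hyperplane says that every derivation kills this ratio.  Hence the
      gradient of F at v is proportional to a vector c over K
      (flat_gauss_constant).

    - Places.  If y is not in K, some place of L with values in K maps y to 0, and
      after dividing v by a suitable coordinate it maps v to a nonzero point P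
      over K (place_specialization).  The gradient of F at v is l c with l a
      nonzero element of L.  If some ratio l / v_j^(d-1) were not in K, a place
      killing it would send v to a point where F and all its partial derivatives
      vanish, against smoothness.  So all these ratios lie in K, hence all ratios
      of coordinates of v do, being roots of elements of K
      (gauss_fiber_algebraic).

    Both facts are proved one element of L at a time.  Subrings of L occur as
    images of morphisms ev : A -> L, adjoining an element means passing from A to
    {poly A}, and a derivation or a place on the image is a map on A which
    vanishes on the kernel of ev. *)

(** * Generic points of infinite sets *)

Lemma maximal_is_kernel (A : comNzRingType) (I : set A) :
    I 0 -> ~ I 1 -> (forall a u v, I u -> I v -> I (a * u + v)) ->
    (forall u, ~ I u -> exists w, I (w * u - 1)) ->
  exists (L : fieldType) (f : {rmorphism A -> L}), forall a, f a = 0 <-> I a.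
Proof.
move=> I0 I1 Ilin Imax; pose inI : pred A := fun a => `[< I a >].
have inI_ideal : idealr_closed inI.
  split; first by apply/asboolP.
    by apply/asboolPn.
  by move=> a u v /asboolP Iu /asboolP Iv; apply/asboolP; apply: Ilin.
pose J : idealr A := HB.pack inI (isIdealr.Build A inI inI_ideal).
pose B : comNzRingType := {ideal_quot J}.
pose f : {rmorphism A -> B} := \pi_B%qT.
have fE a : f a = 0 <-> I a.
  rewrite -(rmorph0 f); split=> [/eqP|Ia]; last apply/eqP.
    by rewrite -Quotient.idealrBE subr0 => /asboolP.
  by rewrite -Quotient.idealrBE subr0; apply/asboolP.
have fK (x : B) : exists a, x = f a by exists (repr x); rewrite -[LHS]reprK.
have inv_ex (x : B) : exists y : B, (x != 0 -> y * x = 1) /\ (x = 0 -> y = 0).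
  have [->|x0] := eqVneq x 0; first by exists 0.
  have [a xE] := fK x; have nIa : ~ I a by move/fE/eqP; rewrite -xE (negPf x0).
  have [w /fE /eqP] := Imax _ nIa; rewrite rmorphB rmorphM rmorph1 -xE subr_eq0.
  by move=> /eqP wx; exists (f w); split=> [//|x_eq0]; rewrite x_eq0 eqxx in x0.
have [inv invP] := choice inv_ex.
pose L : fieldType := HB.pack B (GRing.ComNzRing_isField.Build B
  (fun x => (invP x).1) ((invP 0).2 erefl)).
by exists L, f.
Qed.

(** The field is the ultrapower of K along a nonprincipal ultrafilter U on the
    natural numbers, and v is the class of the sequence s: a polynomial vanishes
    at v exactly when it vanishes at s k for U-almost all k.  The first clause is
    the case of all k; the second says that finitely many equations satisfied by
    v hold together at arbitrarily late terms of the sequence. *)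
Lemma generic_point (K : fieldType) (n : nat) (s : nat -> 'I_n -> K) :
  exists (L : fieldType) (iota : {rmorphism K -> L}) (v : 'I_n -> L),
    (forall q, (forall k, q.@[s k] = 0) -> mmap iota v q = 0) /\
    (forall qs : seq {mpoly K[n]}, {in qs, forall q, mmap iota v q = 0} ->
       forall m, exists2 k, (m <= k)%N & {in qs, forall q, q.@[s k] = 0}).
Proof.
pose G : set_system nat := [set A | exists m, forall k, (m <= k)%N -> A k].
have GF : ProperFilter G.
  split; first by case=> m /(_ m (leqnn m)).
  split; first by exists 0%N.
    move=> A B [a Aa] [b Bb]; exists (maxn a b) => k; rewrite geq_max.
    by move=> /andP[/Aa ? /Bb ?]; split.
  by move=> A B AB [m Am]; exists m => k /Am /AB.
(* U contains the complements of finite sets, hence is nonprincipal. *)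
have [U [UU GU]] := ultraFilterLemma GF.
pose I : set (nat -> K) := [set a | U [set k | a k = 0]].
have [||a b c Ib Ic|a nIa|L [f fE]] := @maximal_is_kernel (nat -> K) I.
- by apply: filterS filterT => k _.
- by move=> I1; apply: (@filter_not_empty _ U); apply: filterS I1 => k /eqP;
    rewrite oner_eq0.
- by apply: filterS (filterI Ib Ic) => k [bk ck] /=;
    rewrite -[LHS]/(a k * b k + c k) bk ck mulr0 addr0.
- exists (fun k => (a k)^-1).
  have [//|] := in_ultra_setVsetC [set k | a k = 0] UU.
  by apply: filterS => k /eqP ak /=;
    rewrite -[LHS]/((a k)^-1 * a k - 1) mulVf ?subrr.
have cst_add : zmod_morphism (fun c : K => f (fun=> c)).
  by move=> x y; rewrite -rmorphB.
have cst_mul : monoid_morphism (fun c : K => f (fun=> c)).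
  by split=> [|x y]; rewrite -?rmorphM -?(rmorph1 f).
pose iota : {rmorphism K -> L} := HB.pack (fun c : K => f (fun=> c))
  (GRing.isZmodMorphism.Build _ _ _ cst_add)
  (GRing.isMonoidMorphism.Build _ _ _ cst_mul).
exists L, iota, (fun i => f (s^~ i)).
have evE q : mmap iota (fun i => f (s^~ i)) q = f (fun k => q.@[s k]).
  rewrite /mmap /= (_ : (fun k => q.@[s k]) =
    \sum_(m <- msupp q) (fun=> q@_m) * \prod_(i < n) (s^~ i) ^+ m i).
    rewrite rmorph_sum; apply: eq_bigr => m _; rewrite rmorphM rmorph_prod.
    by congr (_ * _); apply: eq_bigr => i _; rewrite rmorphXn.
  apply/funext => k; rewrite mevalE fct_sumE; apply: eq_bigr => m _.
  rewrite /GRing.mul /= fct_prodE; congr (_ * _); apply: eq_bigr => i _.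
  by elim: (m i) => [//|e IHe]; rewrite !exprS IHe.
split=> [q q0|qs qs0 m].
  by rewrite evE; apply/fE; apply: filterS filterT => k _; apply: q0.
have Uall : U [set k | {in qs, forall q, q.@[s k] = 0}].
  elim: qs qs0 => [|q qs IHqs] qs0.
    by apply: filterS filterT.
  have Uq : U [set k | q.@[s k] = 0].
    by apply/fE; rewrite -evE qs0 ?mem_head.
  have := IHqs (fun p qsp => qs0 p (mem_behead (s := q :: qs) qsp)).
  apply: filterS2 Uq => k qk qsk p; rewrite inE => /predU1P[->//|].
  exact: qsk.
have Um : U [set k | (m <= k)%N] by apply: GU; exists m.
by have [k [mk qsk]] := filter_ex (filterI Um Uall); exists k.
Qed.

(** * Evaluation and derivatives of multivariate polynomials *)

Lemma mpoly_ring_ind (n : nat) (K : comNzRingType) (P : {mpoly K[n]} -> Prop) :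
    (forall c, P c%:MP) -> (forall i, P 'X_i) ->
    (forall p q, P p -> P q -> P (p + q)) ->
    (forall p q, P p -> P q -> P (p * q)) ->
  forall p, P p.
Proof.
move=> PC PX PD PM p; rewrite [p]mpolyE.
apply: (big_ind P) => [||m _]; [exact: (PC 0)|exact: PD|].
rewrite -mul_mpolyC; apply: (PM); first exact: PC.
rewrite mpolyXE_id; apply: (big_ind P) => [||i _]; [exact: (PC 1)|exact: PM|].
by elim: (m i) => [|e IHe]; [exact: (PC 1)|rewrite exprS; apply: PM].
Qed.

Lemma rmorph_mmap (n : nat) (K A B : comNzRingType) (kappa : {rmorphism K -> A})
    (f : {rmorphism A -> B}) (iota : {rmorphism K -> B}) (a : 'I_n -> A)
    (v : 'I_n -> B) :
    (forall c, f (kappa c) = iota c) -> (forall i, f (a i) = v i) ->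
  forall g, f (mmap kappa a g) = mmap iota v g.
Proof.
move=> fk fa; elim/mpoly_ring_ind => [c|i|p q IHp IHq|p q IHp IHq].
- by rewrite !mmapC fk.
- by rewrite !mmapX !mmap1U fa.
- by rewrite !rmorphD /= IHp IHq.
- by rewrite !rmorphM /= IHp IHq.
Qed.

Definition derivation_along (A B : comNzRingType) (ev : {rmorphism A -> B})
    (tau : {additive A -> B}) :=
  forall a b, tau (a * b) = ev a * tau b + tau a * ev b.

(** The chain rule.  It serves twice: with ev an evaluation in a field, for
    derivations at a point, and with ev the identity, to differentiate a
    composition of polynomials. *)
Lemma derivation_mmap (n : nat) (K A B : comNzRingType)
    (kappa : {rmorphism K -> A}) (ev : {rmorphism A -> B})
    (tau : {additive A -> B}) (a : 'I_n -> A) :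
    derivation_along ev tau -> (forall c, tau (kappa c) = 0) ->
  forall g, tau (mmap kappa a g) =
            \sum_i ev (mmap kappa a g^`M(i)) * tau (a i).
Proof.
move=> tauM tauK; elim/mpoly_ring_ind => [c|i|p q IHp IHq|p q IHp IHq].
- by rewrite mmapC tauK big1 // => i _; rewrite mderivC !rmorph0 mul0r.
- rewrite mmapX mmap1U (bigD1 i) //= big1 => [|j ji].
    have -> : ('X_i : {mpoly K[n]})^`M(i) = 1.
      rewrite mderivX mnm1E eqxx scale1r -mpolyX0; congr 'X_[_].
      by apply/mnmP => j; rewrite mnmBE subnn mnm0E.
    by rewrite !rmorph1 mul1r addr0.
  by rewrite mderivX mnm1E eq_sym (negPf ji) scale0r !rmorph0 mul0r.
- rewrite rmorphD raddfD /= IHp IHq -big_split /=; apply: eq_bigr => i _.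
  by rewrite mderivD !rmorphD /= mulrDl.
- rewrite rmorphM /= tauM IHp IHq mulr_sumr mulr_suml -big_split /=.
  by apply: eq_bigr => i _; rewrite mderivM !(rmorphD, rmorphM) /=; ring.
Qed.

Lemma mmap_homog_scale (n d : nat) (K L : comNzRingType)
    (iota : {rmorphism K -> L}) (c : L) (w : 'I_n -> L) (p : {mpoly K[n]}) :
  p \is d.-homog -> mmap iota (fun i => c * w i) p = c ^+ d * mmap iota w p.
Proof.
move=> /dhomogP hp; rewrite /mmap mulr_sumr; apply: eq_big_seq => m /hp md.
rewrite mulrCA; congr (_ * _); rewrite /mmap1 -md /= mdegE -prodrXr -big_split.
by apply: eq_bigr => i _; rewrite exprMn.
Qed.

Lemma mderiv_homog (n d : nat) (K : comNzRingType) (i : 'I_n)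
    (p : {mpoly K[n]}) :
  p \is d.-homog -> p^`M(i) \is d.-1.-homog.
Proof.
move=> /dhomogP hp; apply/dhomogP => m; rewrite mcoeff_msupp mcoeff_mderiv => h.
have mp : (m + U_(i))%MM \in msupp p.
  by rewrite mcoeff_msupp; apply: contraNneq h => ->; rewrite mul0rn.
by have /= := hp _ mp; rewrite mdegD mdeg1 addn1 => <-.
Qed.

Lemma euler_identity (n d : nat) (K : comNzRingType) (p : {mpoly K[n]}) :
  p \is d.-homog -> \sum_i 'X_i * p^`M(i) = p *+ d.
Proof.
move=> /dhomogP hp; rewrite [in RHS](mpolyE p) -sumrMnl.
under eq_bigr do rewrite [X in X^`M(_)](mpolyE p) raddf_sum mulr_sumr.
rewrite exchange_big; apply: eq_big_seq => m /hp /= md.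
rewrite -md mdegE -mulr_natr natr_sum mulr_sumr; apply: eq_bigr => i _.
rewrite mderivZ mderivX.
have [->|mi] := eqVneq (m i) 0%N; first by rewrite scale0r scaler0 !mulr0.
rewrite -!scalerAr -mpolyXD addmC submK; last by rewrite lep1mP.
by rewrite mulr_natr scaler_nat scalerMnr.
Qed.

Lemma meval_origin (n : nat) (K : comNzRingType) (p : {mpoly K[n]}) :
  p.@[fun=> 0] = p@_0.
Proof.
elim/mpoly_ring_ind: p => [c|i|p q IHp IHq|p q IHp IHq].
- by rewrite mevalC mcoeffC eqxx mulr1.
- by rewrite mevalXU mcoeffX mnm1_eq0.
- by rewrite mevalD mcoeffD IHp IHq.
- by rewrite mevalM rmorphM /= IHp IHq.
Qed.

(** * Extending derivations *)

(** Adjoining x to the image of ev.  Every derivation extending tau has the form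
    p |-> p^tau(x) + delta p'(x), so the question is whether delta can be chosen
    to kill all relations p(x) = 0.  If x is transcendental, delta = 0 does.
    Otherwise a relation p of least degree forces the value of delta, because
    p'(x) is nonzero in characteristic 0; every other relation then reduces to 0
    modulo p by pseudo-division. *)
Lemma derivation_extend (A : comNzRingType) (L : fieldType)
    (ev : {rmorphism A -> L}) (tau : {additive A -> L}) (x : L) :
    [pchar L] =i pred0 ->
    derivation_along ev tau -> (forall a, ev a = 0 -> tau a = 0) ->
  exists (ev' : {rmorphism {poly A} -> L}) (tau' : {additive {poly A} -> L}),
    [/\ derivation_along ev' tau', forall p, ev' p = 0 -> tau' p = 0,
        forall c, ev' c%:P = ev c, forall c, tau' c%:P = tau c & ev' 'X = x].
Proof.
move=> L0 tauM kertau.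
have [ev' ev'E] : exists ev' : {rmorphism {poly A} -> L},
    forall p, ev' p = (map_poly ev p).[x].
  by exists (horner_eval x \o map_poly ev).
have ev'C c : ev' c%:P = ev c by rewrite ev'E map_polyC hornerC.
have ev'X : ev' 'X = x by rewrite ev'E map_polyX hornerX.
pose D p := (map_poly tau p).[x].
have DXM p : D (p * 'X) = D p * x.
  rewrite /D -hornerMX; congr (_.[_]); apply/polyP => i.
  by rewrite coef_map !coefMX coef_map; case: eqP => // _; rewrite raddf0.
have DCM c p : D (c%:P * p) = ev c * D p + tau c * ev' p.
  rewrite /D ev'E -!hornerCM -hornerD; congr (_.[_]); apply/polyP => i.
  by rewrite !(coefD, coefCM, coef_map) tauM.
have DC c : D c%:P = tau c by rewrite /D map_polyC hornerC.
pose tau0 delta p := D p + delta * ev' p^`().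
have tau0B delta : zmod_morphism (tau0 delta).
  move=> p q; rewrite /tau0 derivB rmorphB /D raddfB /= hornerD hornerN /=; ring.
pose tau' delta : {additive {poly A} -> L} :=
  HB.pack (tau0 delta) (GRing.isZmodMorphism.Build _ _ _ (tau0B delta)).
(* The product rule holds for every value of delta. *)
have tau'M delta : derivation_along ev' (tau' delta).
  rewrite /derivation_along /= /tau0 => p q.
  elim/poly_ind: p => [|p c IHp].
    by rewrite mul0r !raddf0 /D !raddf0 /= horner0; ring.
  have DD r t : D (r + t) = D r + D t by rewrite /D raddfD hornerD.
  have -> : (p * 'X + c%:P) * q = (p * q) * 'X + c%:P * q by ring.
  rewrite !DD !DXM !DCM DC !derivE !(rmorphD, rmorphM) /= ev'C ev'X.
  move/eqP: IHp; rewrite derivM rmorphD !rmorphM /= -subr_eq0 opprD addrA.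
  rewrite rmorph1 => /eqP IHp; apply/eqP; rewrite -subr_eq0.
  apply/eqP; rewrite -[RHS](mul0r x) -IHp; ring.
have ker0 delta p : map_poly ev p = 0 -> tau' delta p = 0.
  move=> p0; rewrite /= /tau0 ev'E -deriv_map p0 deriv0 horner0 mulr0 addr0 /D.
  rewrite (_ : map_poly tau p = 0) ?horner0 //; apply/polyP => i.
  by rewrite coef_map coef0 kertau // -coef_map p0 coef0.
have tau'C delta c : tau' delta c%:P = tau c.
  by rewrite /= /tau0 DC derivC raddf0 mulr0 addr0.
(* The degree of a relation is measured after mapping its coefficients to L,
   since a leading coefficient in A may die there. *)
pose rel n p := ev' p = 0 /\ size (map_poly ev p) = n.+1.
have [[n [p pn]]|norel] := pselect (exists n p, rel n p); last first.
  exists ev', (tau' 0); split=> // p p0; apply: ker0; apply/eqP.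
  rewrite -size_poly_eq0; case E: size => [//|n].
  by case: norel; exists n, p.
have ex_rel : exists n, `[< exists p, rel n p >].
  by exists n; apply/asboolP; exists p.
case: (ex_minnP ex_rel) => {n p pn} n /asboolP[p [p0 pn]] n_min.
have {}n_min q : ev' q = 0 -> (size (map_poly ev q) <= n)%N -> map_poly ev q = 0.
  move=> q0; case E: (size _) => [|m] mn; first by apply/eqP; rewrite -size_poly_eq0 E.
  suff : (n <= m)%N by rewrite leqNgt mn.
  by apply: n_min; apply/asboolP; exists q.
have p'0 : ev' p^`() != 0.
  apply/eqP => p'0; have n0 : (0 < n)%N.
    rewrite lt0n; apply/eqP => n0; have := pn; rewrite n0 => /eqP/size_poly1P.
    by case=> c c0 pE; move/eqP: p0; rewrite ev'E pE hornerC (negPf c0).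
  have /polyP/(_ n.-1)/eqP : map_poly ev p^`() = 0.
    apply: n_min => //; rewrite -deriv_map -ltnS -pn lt_size_deriv //.
    by rewrite -size_poly_eq0 pn.
  rewrite -deriv_map coef_deriv coef0 prednK // -mulr_natr mulf_eq0.
  rewrite ((pcharf0P L).1 L0) eqn0Ngt n0 orbF.
  by rewrite -[n]/(n.+1.-1) -pn -lead_coefE lead_coef_eq0 -size_poly_eq0 pn.
pose delta := - D p / ev' p^`().
have taup : tau' delta p = 0 by rewrite /= /tau0 /delta divfK // subrr.
exists ev', (tau' delta); split=> // q.
have [m] := ubnP (size (map_poly ev q)); elim: m q => // m IHm q qm q0.
have [/(n_min q q0)/ker0->//|nq] := leqP (size (map_poly ev q)) n.
(* One step of pseudo-division of q by p; it does not divide, as A has no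
   inverses. *)
pose k := (size (map_poly ev q) - n.+1)%N.
pose r := (p`_n)%:P * q - (q`_(k + n))%:P * ('X^k * p).
have r0 : ev' r = 0 by rewrite !(rmorphB, rmorphM) /= p0 q0; ring.
have sE : size (map_poly ev q) = (k + n).+1 by rewrite -addnS subnK.
have rm : (size (map_poly ev r) < m)%N.
  rewrite -ltnS (leq_trans _ qm) // ltnS sE ltnS; apply/leq_sizeP => j.
  rewrite leq_eqVlt => /predU1P[<-|kj]; rewrite coef_map coefB !coefCM coefXnM.
    by rewrite ltnNge leq_addr /= addKn rmorphB !rmorphM /= mulrC subrr.
  rewrite ltnNge (leq_trans (leq_addr n k) (ltnW kj)) /= rmorphB !rmorphM /=.
  have qj : ev q`_j = 0 by rewrite -coef_map nth_default // sE.
  have pj : ev p`_(j - k) = 0.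
    by rewrite -coef_map nth_default // pn ltn_subRL.
  by rewrite qj pj !mulr0 subrr.
have pn0 : ev p`_n != 0.
  by rewrite -coef_map -[n]/(n.+1.-1) -pn -lead_coefE lead_coef_eq0
             -size_poly_eq0 pn.
have := IHm _ rm r0; rewrite raddfB !(tau'M delta) rmorphM q0 p0 taup ev'C.
rewrite !(mulr0, addr0, subr0) => /eqP.
by rewrite mulf_eq0 (negPf pn0) => /eqP.
Qed.

(** As K is algebraically closed, an element of L outside K is transcendental
    over K. *)
Lemma transcendental_horner_inj (K : closedFieldType) (L : fieldType)
    (iota : {rmorphism K -> L}) (y : L) :
    (forall c, iota c != y) ->
  forall p : {poly K}, (map_poly iota p).[y] = 0 -> p = 0.
Proof.
move=> yK p py; have [r pE] := closed_field_poly_normal p.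
apply/eqP; rewrite -lead_coef_eq0; apply: contraT => lp0.
move/eqP: py; rewrite pE linearZ /= rmorph_prod /= hornerZ horner_prod mulf_eq0.
rewrite fmorph_eq0 (negPf lp0) /= prodf_seq_eq0 => /hasP[c _ /=].
by rewrite map_polyXsubC hornerXsubC subr_eq0 eq_sym (negPf (yK c)).
Qed.

Section Tangent.
Variables (K : closedFieldType) (L : fieldType) (iota : {rmorphism K -> L}).
Variable y : L.
Hypotheses (K0 : [pchar K] =i pred0) (yK : forall c, iota c != y).

(** Starts from d/dy on K[y] and adjoins the elements of s one after the other. *)
Lemma derivation_tower (s : seq L) :
  exists (A : comNzRingType) (kappa : {rmorphism K -> A})
    (ev : {rmorphism A -> L}) (tau : {additive A -> L}),
    [/\ derivation_along ev tau, forall a, ev a = 0 -> tau a = 0,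
        forall c, ev (kappa c) = iota c & forall c, tau (kappa c) = 0] /\
    (exists2 b, ev b = y & tau b = 1) /\ {in s, forall x, exists a, ev a = x}.
Proof.
have L0 : [pchar L] =i pred0 by move=> p; rewrite (fmorph_pchar iota) K0.
elim: s => [|x s [A [kappa [ev [tau [[tauM kertau evK tauK] [[b evb taub] sA]]]]]]].
  have [ev evE] : exists ev : {rmorphism {poly K} -> L},
      forall p, ev p = (map_poly iota p).[y].
    by exists (horner_eval y \o map_poly iota).
  pose tau : {additive {poly K} -> L} := ev \o (@deriv K).
  exists {poly K}, (@polyC K), ev, tau; split; [split|split=> //].
  - by move=> p q; rewrite /tau /= derivM rmorphD !rmorphM addrC /=.
  - move=> p; rewrite evE => /(transcendental_horner_inj yK) ->.
    by rewrite raddf0.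
  - by move=> c; rewrite evE map_polyC hornerC.
  - by move=> c; rewrite /tau /= derivC rmorph0.
  - by exists 'X; rewrite /tau /= ?derivX ?rmorph1 // evE map_polyX hornerX.
have [ev' [tau' [tauM' kertau' ev'C tau'C ev'X]]] :=
  derivation_extend x L0 tauM kertau.
exists {poly A}, (@polyC A \o kappa), ev', tau'; split; [split=> //|split].
- by move=> c; rewrite /= ev'C.
- by move=> c; rewrite /= tau'C.
- by exists b%:P; rewrite ?ev'C ?tau'C.
- move=> z; rewrite inE => /predU1P[->|/sA[a <-]]; first by exists 'X.
  by exists a%:P.
Qed.

(** The vector delta consists of the values at v of a derivation D with D y = 1;
    the conclusion is D applied to g(v) = y h(v).  For h = 0 it says that delta is
    tangent at v to every hypersurface over K through v. *)
Lemma tangent_vector (n : nat) (v : 'I_n -> L) :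
  exists delta : 'I_n -> L, forall g h,
    mmap iota v g = y * mmap iota v h ->
    \sum_i mmap iota v g^`M(i) * delta i =
    mmap iota v h + y * \sum_i mmap iota v h^`M(i) * delta i.
Proof.
have [A [kappa [ev [tau [[tauM kertau evK tauK] [[b evb taub] sA]]]]]] :=
  derivation_tower (codom v).
have /fin_all_exists[a eva] : forall i, exists a, ev a = v i.
  by move=> i; apply: sA; apply: codom_f.
exists (tau \o a) => g h.
have evE := rmorph_mmap evK eva; have dE := derivation_mmap a tauM tauK.
have dv q : \sum_i mmap iota v q^`M(i) * tau (a i) = tau (mmap kappa a q).
  by rewrite dE; apply: eq_bigr => i _; rewrite evE.
rewrite !dv -!evE -evb -rmorphM => /eqP.
rewrite -subr_eq0 -rmorphB => /eqP/kertau/eqP.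
by rewrite raddfB subr_eq0 /= tauM taub mul1r addrC => /eqP.
Qed.
End Tangent.

(** * Extending places *)

Section PlaceExtension.
Variables (K : closedFieldType) (L : fieldType) (A : comNzRingType).
Variables (kappa : {rmorphism K -> A}) (ev : {rmorphism A -> L}).
Variable phi : {rmorphism A -> K}.
Hypotheses (phiK : cancel kappa phi) (kerphi : forall a, ev a = 0 -> phi a = 0).

(** A morphism extending phi to the ring generated by x must respect every relation
    p(x) = 0, and a relation that phi reduces to 1 = 0 forbids it. *)
Let obstructed x := exists2 p, (map_poly ev p).[x] = 0 & map_poly phi p = 1.

(** Chevalley's argument.  Two obstructing relations, p for x and q for x^-1, of
    sizes m >= n: multiplying q by x^(n-1) gives a relation for x whose leading
    coefficient is mapped to 1 by phi and whose other coefficients to 0.  It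
    cancels the top term of p without changing the reduction of p, which produces
    a smaller pair. *)
Lemma obstructed_unsymmetric x : x != 0 -> obstructed x -> ~ obstructed x^-1.
Proof.
move=> + [p + +] [q].
have [m] := ubnP (size p + size q)%N; elim: m x p q => // m IHm x p q.
wlog le_qp : x p q / (size q <= size p)%N => [hw|].
  have [|/ltnW] := leqP (size q) (size p); first exact: hw.
  move=> pq pqm x0 px p1 qx q1; apply: (hw x^-1 q p); rewrite ?invrK ?invr_eq0 //.
  by rewrite addnC.
move=> pqm x0 px p1 qx q1; pose n := size q.
have q0 : phi q`_0 = 1 by rewrite -coef_map q1 coef1.
have n0 : (0 < n)%N.
  rewrite lt0n size_poly_eq0; apply/eqP => qE.
  by have := oner_neq0 K; rewrite -q0 qE coef0 rmorph0 eqxx.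
have p_gt1 : (1 < size p)%N.
  rewrite ltnNge; apply/negP => /size1_polyC pE.
  move: px p1; rewrite pE !map_polyC !hornerC => /kerphi /= -> /eqP.
  by rewrite eq_sym oner_eq0.
pose q' := \poly_(i < n) q`_(n.-1 - i).
have q'x : (map_poly ev q').[x] = 0.
  rewrite -[RHS](mulr0 (x ^+ n.-1)) -qx.
  rewrite (@horner_coef_wide _ n); last first.
    by rewrite (leq_trans (size_poly _ _)) // size_poly.
  rewrite (@horner_coef_wide _ n _ x^-1) ?size_poly // mulr_sumr.
  rewrite (reindex_inj rev_ord_inj); apply: eq_bigr => i _ /=.
  have i1 : (i <= n.-1)%N by rewrite -ltnS prednK.
  have -> : (n - i.+1 = n.-1 - i)%N by rewrite -subn1 -subnDA add1n.
  rewrite !coef_map coef_poly (leq_ltn_trans (leq_subr _ _)) ?prednK // subKn //.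
  rewrite mulrCA exprVn; congr (_ * _).
  by rewrite -{2}(subnK i1) exprD mulfK ?expf_neq0.
pose k := (size p - n)%N; pose r := (q`_0)%:P * p - (p`_(size p).-1)%:P * ('X^k * q').
have rx : (map_poly ev r).[x] = 0.
  by rewrite !(rmorphB, rmorphM, hornerD, hornerN, hornerM) /= px q'x; ring.
have r1 : map_poly phi r = 1.
  rewrite rmorphB !rmorphM /= !map_polyC /= q0 p1 -coef_map p1 coef1.
  by rewrite -[_ == _]/((size p).-1 == 0)%N -subn1 subn_eq0 leqNgt p_gt1 /=; ring.
have rp : (size r < size p)%N.
  rewrite -[X in (_ < X)%N](ltn_predK p_gt1) ltnS; apply/leq_sizeP => j.
  rewrite coefB !coefCM coefXnM coef_poly.
  have kE : (k + n = size p)%N by rewrite subnK.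
  rewrite leq_eqVlt => /predU1P[<-|jp].
    have -> : (size p).-1 = (k + n.-1)%N by rewrite -kE -[in LHS](prednK n0) addnS.
    by rewrite ltnNge leq_addr /= addKn prednK // leqnn subnn mulrC subrr.
  have kj : (k + n <= j)%N by rewrite kE -(ltn_predK p_gt1).
  have kj' : (k <= j)%N by apply: leq_trans kj; apply: leq_addr.
  have -> : (j < k)%N = false by rewrite ltnNge kj'.
  have -> : (j - k < n)%N = false.
    by apply/negbTE; rewrite -leqNgt leq_subRL.
  by rewrite [p`_j]nth_default -?kE // !mulr0 subrr.
rewrite ltnS in pqm.
by apply: (IHm x r q) => //; apply: leq_trans pqm; rewrite ltn_add2r.
Qed.

(** The reductions of the relations of x form an ideal of K[X], because phi is
    onto K.  If it does not contain 1, its generator has a root in K, and this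
    root is an admissible value for x. *)
Lemma unobstructed_extend x : ~ obstructed x ->
  exists (ev' : {rmorphism {poly A} -> L}) (phi' : {rmorphism {poly A} -> K}),
    [/\ forall p, ev' p = 0 -> phi' p = 0, forall c, ev' c%:P = ev c,
        forall c, phi' c%:P = phi c & ev' 'X = x].
Proof.
move=> unobs; pose J j := exists2 p, (map_poly ev p).[x] = 0 & map_poly phi p = j.
have [xi xiP] : exists xi, forall j, J j -> j.[xi] = 0.
  have [allJ0|] := pselect (forall j, J j -> j = 0).
    by exists 0 => j /allJ0 ->; rewrite horner0.
  move=> /existsNP[j0 /not_implyP[Jj0 /eqP j0_neq0]].
  have ex_size : exists n, `[< exists2 j, J j & j != 0 /\ size j = n >].
    by exists (size j0); apply/asboolP; exists j0.
  case: (ex_minnP ex_size) => n /asboolP[j Jj [j_neq0 jn]] n_min.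
  have J_dvd i : J i -> j %| i.
    move=> Ji; apply: contraT; rewrite /dvdp => mod0.
    have := ltn_modpN0 i j_neq0; rewrite jn ltnNge n_min //.
    apply/asboolP; exists (i %% j) => //.
    have [p px pj] := Jj; have [q qx qi] := Ji.
    exists (q - map_poly kappa (i %/ j) * p).
      by rewrite rmorphB rmorphM hornerD hornerN hornerM px qx mulr0 subrr.
    rewrite rmorphB rmorphM /= pj qi -map_poly_comp map_poly_id //.
      by rewrite {1}(divp_eq i j) addrAC subrr add0r.
    by move=> c _ /=; rewrite phiK.
  have j_gt1 : size j != 1%N.
    apply/eqP => /eqP/size_poly1P[c c0 jE]; have [p px pj] := Jj; apply: unobs.
    exists ((kappa c^-1)%:P * p); first by rewrite rmorphM hornerM px mulr0.
    by rewrite rmorphM /= map_polyC /= phiK pj jE -polyCM mulVf.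
  have /closed_rootP[xi rt] := j_gt1; exists xi => i /J_dvd ji.
  by rewrite -(divpK ji) hornerM (rootP rt) mulr0.
exists (horner_eval x \o map_poly ev), (horner_eval xi \o map_poly phi).
split=> /= [p px|c|c|]; rewrite /horner_eval ?map_polyC ?hornerC //.
  by apply: xiP; exists p.
by rewrite map_polyX hornerX.
Qed.

Lemma place_extend x : x != 0 ->
  exists (ev' : {rmorphism {poly A} -> L}) (phi' : {rmorphism {poly A} -> K}),
    [/\ forall p, ev' p = 0 -> phi' p = 0, forall c, ev' c%:P = ev c,
        forall c, phi' c%:P = phi c & ev' 'X = x \/ ev' 'X = x^-1].
Proof.
move=> x0; have [obs|/unobstructed_extend] := pselect (obstructed x); last first.
  by move=> [e [f [? ? ? ?]]]; exists e, f; split=> //; left.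
have [e [f [? ? ? ?]]] := unobstructed_extend (obstructed_unsymmetric x0 obs).
by exists e, f; split=> //; right.
Qed.
End PlaceExtension.

Section Place.
Variables (K : closedFieldType) (L : fieldType) (iota : {rmorphism K -> L}).
Variable y : L.
Hypothesis yK : forall c, iota c != y.

(** Starts from the morphism K[y] -> K that maps y to 0. *)
Lemma place_tower (s : seq L) : {in s, forall x, x != 0} ->
  exists (A : comNzRingType) (kappa : {rmorphism K -> A})
    (ev : {rmorphism A -> L}) (phi : {rmorphism A -> K}),
    [/\ forall a, ev a = 0 -> phi a = 0, cancel kappa phi,
        forall c, ev (kappa c) = iota c & exists2 b, ev b = y & phi b = 0] /\
    {in s, forall x, exists a, ev a = x \/ ev a = x^-1}.
Proof.
elim: s => [_|x s IHs s0].
  exists {poly K}, (@polyC K), (horner_eval y \o map_poly iota), (horner_eval 0).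
  split; [split|by []].
  - by move=> p /(transcendental_horner_inj yK) ->; rewrite rmorph0.
  - by move=> c; rewrite /= /horner_eval hornerC.
  - by move=> c; rewrite /= /horner_eval map_polyC hornerC.
  - by exists 'X; rewrite /= /horner_eval ?map_polyX hornerX.
have [z zs|A [kappa [ev [phi [[kerphi phiK evK [b evb phib]] sA]]]]] := IHs.
  by apply: s0; rewrite inE zs orbT.
have [|ev' [phi' [kerphi' ev'C phi'C ev'X]]] :=
  place_extend phiK kerphi (x := x); first by rewrite s0 ?mem_head.
exists {poly A}, (@polyC A \o kappa), ev', phi'; split; [split=> //|].
- by move=> c; rewrite /= phi'C phiK.
- by move=> c; rewrite /= ev'C.
- by exists b%:P; rewrite ?ev'C ?phi'C.
- move=> z; rewrite inE => /predU1P[->|/sA[a aE]]; first by exists 'X.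
  by exists a%:P; rewrite ev'C.
Qed.

(** With the quotients of the coordinates of v adjoined up to inversion,
    divisibility in the image of ev totally preorders the nonzero coordinates; m
    is a largest one in absolute value, so that all v i / v m are finite at the
    place, and P collects their values.  The conclusion is the place applied to
    q(v / v m) = y h(v / v m), which holds with y mapped to 0. *)
Lemma place_specialization (n : nat) (v : 'I_n -> L) (i0 : 'I_n) : v i0 != 0 ->
  exists m (P : 'I_n -> K), [/\ v m != 0, P m = 1 & forall q h,
    mmap iota (fun i => v i / v m) q = y * mmap iota (fun i => v i / v m) h ->
    q.@[P] = 0].
Proof.
move=> vi0.
pose D := [seq i <- enum 'I_n | v i != 0].
have DP i : (i \in D) = (v i != 0) by rewrite mem_filter mem_enum andbT.
have [|A [kappa [ev [phi [[kerphi phiK evK [b evb phib]] sA]]]]] :=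
  @place_tower [seq v i / v j | i <- D, j <- D].
  move=> _ /allpairsP[[i j] [/= iD jD ->]].
  by rewrite mulf_neq0 ?invr_eq0 -?DP.
have ratio i j : i \in D -> j \in D ->
    (exists a, ev a = v i / v j) \/ (exists a, ev a = v j / v i).
  move=> iD jD; have [|a [aE|aE]] := sA (v i / v j).
  - by apply/allpairsP; exists (i, j).
  - by left; exists a.
  - by right; exists a; rewrite aE invf_div.
have [m mD mP] : exists2 m, m \in D & {in D, forall i, exists a, ev a = v i / v m}.
  suff min (s : seq 'I_n) : {subset s <= D} -> s != [::] ->
      exists2 m, m \in s & {in s, forall i, exists a, ev a = v i / v m}.
    by apply: min => //; apply/eqP => DE; move: (DP i0); rewrite vi0 DE.
  elim: s => // i s IHs sD _.
  have iD : i \in D by rewrite sD ?mem_head.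
  have vi : v i != 0 by rewrite -DP.
  have [->|s0] := eqVneq s [::].
    exists i => [|j]; rewrite ?mem_head // inE => /eqP ->.
    by exists 1; rewrite rmorph1 divff.
  have [j js|m ms mP] := IHs _ s0; first by rewrite sD // inE js orbT.
  have mD : m \in D by rewrite sD // inE ms orbT.
  have [imA|[a aE]] := ratio i m iD mD.
    exists m => [|j]; first by rewrite inE ms orbT.
    by rewrite inE => /predU1P[->//|/mP].
  exists i => [|j]; rewrite inE ?eqxx // => /predU1P[->|/mP[c cE]].
    by exists 1; rewrite rmorph1 divff.
  by exists (c * a); rewrite rmorphM aE cE mulrA divfK // -DP.
have vm : v m != 0 by rewrite -DP.
have /fin_all_exists[a aE] : forall i, exists a, ev a = v i / v m.
  move=> i; have [vi|vi] := eqVneq (v i) 0; first by exists 0; rewrite vi mul0r rmorph0.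
  by apply: mP; rewrite DP.
exists m, (phi \o a); split=> //=.
  have /kerphi/eqP : ev (a m - 1) = 0 by rewrite rmorphB rmorph1 aE divff ?subrr.
  by rewrite rmorphB rmorph1 subr_eq0 => /eqP.
move=> q h qh; have evE := rmorph_mmap evK aE.
have phiE := @rmorph_mmap n K A K kappa phi idfun a (phi \o a) phiK (fun=> erefl).
have /kerphi : ev (mmap kappa a q - b * mmap kappa a h) = 0.
  by rewrite rmorphB rmorphM !evE evb qh subrr.
by rewrite rmorphB rmorphM phib mul0r subr0 phiE.
Qed.
End Place.

(** * Star points are flat *)

Definition hessian (n : nat) (K : fieldType) (F : {mpoly K[n]}) (v : 'rV[K]_n) :
    'M[K]_n :=
  \matrix_(i, j) (F^`M(i)^`M(j)).@[fun k => v 0 k].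

Section Flat.
Variables (K : fieldType) (N d : nat) (F : {mpoly K[N.+1]}).
Hypothesis Fd : F \is d.-homog.

Lemma mul_hessian_self v : hessian F v *m v^T = d.-1%:R *: gradient F v.
Proof.
apply/matrixP => i j; rewrite !ord1 !mxE mulr_natl -mevalMn.
rewrite -(euler_identity (mderiv_homog i Fd)).
rewrite rmorph_sum; apply: eq_bigr => k _.
by rewrite !mxE rmorphM /= mevalXU mulrC.
Qed.

(** The entries of the product are the second derivatives at the origin of the
    local equation, by the chain rule applied to an affine chart. *)
Lemma local_equation_order3 (v : 'rV[K]_N.+1) (n : nat) (B : 'M[K]_(n, N.+1)) :
    {in msupp (local_equation F v B), forall m, (3 <= mdeg m)%N} ->
  B *m hessian F v *m B^T = 0.
Proof.
set g := local_equation F v B => g3.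
have derivT (G : {mpoly K[N.+1]}) i : (local_equation G v B)^`M(i) =
    \sum_j B i j *: local_equation G^`M(j) v B.
  rewrite /local_equation /comp_mpoly.
  rewrite (@derivation_mmap _ K _ _ (@mpolyC n K) idfun (mderiv i)) /=.
  - apply: eq_bigr => j _; rewrite mulrC -mul_mpolyC; congr (_ * _).
    rewrite tnth_mktuple raddfD raddf_sum /= mderivC add0r (bigD1 i) //=.
    rewrite big1 => [|k ki].
      rewrite mderivZ mderivX mnm1E eqxx scale1r addr0.
      rewrite -alg_mpolyC -mpolyX0; congr (_ *: 'X_[_]).
      by apply/mnmP => k; rewrite mnmBE subnn mnm0E.
    by rewrite mderivZ mderivX mnm1E (negPf ki) scale0r scaler0.
  - by move=> a b /=; rewrite mderivM; ring.
  - by move=> c; rewrite /= mderivC.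
have at0 (G : {mpoly K[N.+1]}) :
    (local_equation G v B).@[fun=> 0] = G.@[fun j => v 0 j].
  rewrite /local_equation comp_mpoly_meval; apply: meval_eq => j.
  rewrite tnth_mktuple mevalD mevalC rmorph_sum big1 ?addr0 // => i _.
  by rewrite /= mevalZ mevalXU mulr0.
apply/matrixP => i i'; rewrite [RHS]mxE.
have : (g^`M(i)^`M(i')).@[fun=> 0] = 0.
  rewrite meval_origin !mcoeff_mderiv; set m := (_ + _ + _)%MM.
  rewrite [g@_m]memN_msupp_eq0 ?mul0rn //; apply/negP => /g3.
  by rewrite /m !mdegD mdeg0 !mdeg1.
move=> <-; rewrite derivT.
rewrite (raddf_sum (mderiv i')) rmorph_sum /= [LHS]mxE.
under [LHS]eq_bigr do rewrite mxE mulr_suml.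
rewrite [LHS]exchange_big; apply: eq_bigr => j _ /=.
rewrite mderivZ mevalZ derivT rmorph_sum mulr_sumr; apply: eq_bigr => k _ /=.
by rewrite mevalZ at0 !mxE; ring.
Qed.

(** The tangent hyperplane is spanned by the point v and the rows of B.  On the
    rows of B the claim is the vanishing of the quadratic part of the local
    equation; products involving v reduce to it by Euler's identity
    hess(v) v = (d - 1) grad(v), as grad(v) is orthogonal to the hyperplane. *)
Lemma tangent_hessian (P : proj_space K N) (w w' : 'rV[K]_N.+1) :
    (3 <= d)%N -> star_point d F P ->
    w *m gradient F (hcoord P) = 0 -> w' *m gradient F (hcoord P) = 0 ->
  w *m hessian F (hcoord P) *m w'^T = 0.
Proof.
move=> d3 [[FP _] [n [B [_ BL [g_ord _]]]]]; set v := hcoord P in FP BL g_ord *.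
set M := col_mx v B in BL; set H := hessian F v; set l := gradient F v.
have M0 : M *m l = 0.
  by apply/sub_kermxP; rewrite (eqmxP BL).
have [v0 B0] : v *m l = 0 /\ B *m l = 0.
  by apply/eq_col_mx; rewrite -mul_col_mx col_mx0.
have Hv : H *m v^T = d.-1%:R *: l := mul_hessian_self v.
have vH : v *m H = d.-1%:R *: l^T.
  rewrite [RHS](_ : _ = (H *m v^T)^T); last by rewrite Hv linearZ.
  rewrite trmx_mul trmxK; congr (_ *m _); apply/matrixP => i j.
  by rewrite !mxE mderiv_comm.
have lv : l^T *m v^T = 0 by rewrite -trmx_mul v0 trmx0.
have lB : l^T *m B^T = 0 by rewrite -trmx_mul B0 trmx0.
have HM : M *m H *m M^T = 0.
  rewrite tr_col_mx mul_col_mx mul_col_row -[B *m H *m v^T]mulmxA Hv vH.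
  rewrite -!scalemxAl -scalemxAr lv lB B0 !scaler0.
  rewrite local_equation_order3 ?block_mx0 //.
  by move=> m /g_ord; apply: leq_trans.
have sub u : u *m l = 0 -> exists D, u = D *m M.
  by move=> /sub_kermxP uL; apply/submxP; rewrite (eqmxP BL).
move=> /sub[D ->] /sub[D' ->].
by rewrite trmx_mul mulmxA -[D *m M *m H]mulmxA -[D *m _ *m M^T]mulmxA HM
           mulmx0 mul0mx.
Qed.
End Flat.

Lemma hcoord_neq0 (K : fieldType) (N : nat) (P : proj_space K N) : hcoord P != 0.
Proof. exact: valP (repr P). Qed.

Lemma proj_point (K : fieldType) (N : nat) (p : 'rV[K]_N.+1) : p != 0 ->
  exists P (c : K), hcoord P = c *: p.
Proof.
move=> p0; pose u : nonzero_vec K N := exist _ p p0.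
exists (\pi_(proj_space K N) u)%qT.
have /proportionalP[c _ cE] :
    (\pi_(proj_space K N) u == \pi_(proj_space K N) (repr (\pi_(proj_space K N) u)))%qT.
  by rewrite reprK.
by exists c.
Qed.

Lemma proj_eq (K : fieldType) (N : nat) (P Q : proj_space K N) (c : K) :
  hcoord P = c *: hcoord Q -> P = Q.
Proof.
move=> PQ; apply/eqP; rewrite eq_sym -[P]reprK -[Q]reprK.
apply/proportionalP; exists c => //; apply: contraNneq (hcoord_neq0 P) => c0.
by rewrite PQ c0 scale0r.
Qed.

(** The value w^T H w' of the Hessian H of F on the tangent vectors
    w = F_i e_j - F_j e_i and w' = F_j e_m - F_m e_j, as a polynomial in the
    coordinates of the point.  Encoding flatness by polynomials over K is what
    transfers it to a generic point. *)
Definition flatness_form (n : nat) (K : comNzRingType) (F : {mpoly K[n]})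
    (i j m : 'I_n) : {mpoly K[n]} :=
  F^`M(i) * F^`M(j) * F^`M(j)^`M(m) - F^`M(i) * F^`M(m) * F^`M(j)^`M(j)
  - F^`M(j) * F^`M(j) * F^`M(i)^`M(m) + F^`M(j) * F^`M(m) * F^`M(i)^`M(j).

Lemma star_point_flatness (K : fieldType) (N d : nat) (F : {mpoly K[N.+1]}) P i j m :
    (3 <= d)%N -> F \is d.-homog -> star_point d F P ->
  (flatness_form F i j m).@[fun k => hcoord P 0 k] = 0.
Proof.
move=> d3 Fd starP; set v := hcoord P; set l := gradient F v.
pose w a b : 'rV[K]_N.+1 := l a 0 *: delta_mx 0 b - l b 0 *: delta_mx 0 a.
have wl a b : w a b *m l = 0.
  rewrite mulmxBl -!scalemxAl -!rowE; apply/matrixP => r c.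
  by rewrite !ord1 !mxE mulrC subrr.
have wT a b : (w a b)^T = l a 0 *: delta_mx b 0 - l b 0 *: delta_mx a 0.
  by rewrite /w linearB !linearZ /= !trmx_delta.
have := tangent_hessian Fd d3 starP (wl i j) (wl j m).
rewrite wT mulmxBr -!scalemxAr -!colE !mulmxBl -!scalemxAl -!rowE.
move=> /matrixP/(_ 0 0).
rewrite !mxE !(mevalD, mevalN, mevalM) => <-; ring.
Qed.

(** * Finiteness *)

Section GenericPoint.
Variables (K : closedFieldType) (L : fieldType) (iota : {rmorphism K -> L}).
Variables (n : nat) (v : 'I_n -> L) (F : {mpoly K[n]}).
Local Notation ev := (mmap iota v).

(** A ratio outside K would have derivative 1 along some delta.  Summing the
    flatness relations against delta, which is tangent to F = 0, shows that its
    derivative is 0. *)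
Lemma flat_gauss_constant (i j : 'I_n) :
    [pchar K] =i pred0 -> ev F = 0 ->
    (forall m, ev (flatness_form F i j m) = 0) -> ev F^`M(j) != 0 ->
  exists c, iota c = ev F^`M(i) / ev F^`M(j).
Proof.
move=> K0 F0 flat lj.
have [//|/forallNP noc] := pselect (exists c, iota c = ev F^`M(i) / ev F^`M(j)).
set y := _ / _ in noc; have yK c : iota c != y by apply/eqP.
have [delta deltaP] := tangent_vector K0 yK v.
have yE : ev F^`M(i) = y * ev F^`M(j) by rewrite divfK.
have dF : \sum_k ev F^`M(k) * delta k = 0.
  rewrite (deltaP F 0) ?rmorph0 ?mulr0 // add0r big1 ?mulr0 // => k _.
  by rewrite raddf0 rmorph0 mul0r.
have := deltaP _ _ yE; set di := \sum_k _; set dj := \sum_k _ => didj.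
have : \sum_m ev (flatness_form F i j m) * delta m = 0.
  by apply: big1 => m _; rewrite flat mul0r.
have -> : \sum_m ev (flatness_form F i j m) * delta m =
    ev F^`M(j) * (ev F^`M(i) * dj - ev F^`M(j) * di) +
    (ev F^`M(j) * ev F^`M(i)^`M(j) - ev F^`M(i) * ev F^`M(j)^`M(j)) *
    \sum_k ev F^`M(k) * delta k.
  under eq_bigr do rewrite /flatness_form !(rmorphB, rmorphD, rmorphM) /=.
  rewrite /di /dj; move: (ev F^`M(i)) (ev F^`M(j)).
  move: (ev F^`M(i)^`M(j)) (ev F^`M(j)^`M(j)) => hij hjj li lj'.
  rewrite !mulr_sumr -sumrB mulr_sumr -big_split /=.
  by apply: eq_bigr => m _; ring.
(* As D y = 1, the bracket equals - (F_j)^2, which is nonzero. *)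
rewrite dF mulr0 addr0 didj yE => /eqP; rewrite mulf_eq0 (negPf lj) /=.
rewrite (_ : _ - _ = - (ev F^`M(j) * ev F^`M(j))); last by ring.
by rewrite oppr_eq0 mulf_eq0 (negPf lj).
Qed.
End GenericPoint.

Section Finiteness.
Variables (K : closedFieldType) (N d : nat) (F : {mpoly K[N.+1]}).
Hypotheses (K0 : [pchar K] =i pred0) (d3 : (3 <= d)%N) (Fd : F \is d.-homog).
Hypothesis smoothF : smooth_hypersurface F.

Lemma no_affine_singular_point (p : 'I_N.+1 -> K) (m : 'I_N.+1) :
  p m != 0 -> F.@[p] = 0 -> ~ forall i, F^`M(i).@[p] = 0.
Proof.
move=> pm Fp dFp; have pT0 : \row_i p i != 0.
  by apply/eqP => /rowP/(_ m); rewrite !mxE => /eqP; rewrite (negPf pm).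
have [P [c PE]] := proj_point pT0.
have scale e q : q \is e.-homog -> q.@[p] = 0 -> q.@[fun i => hcoord P 0 i] = 0.
  move=> qe qp; rewrite -(mulr0 (c ^+ e)) -qp -(mmap_homog_scale idfun c p qe).
  by apply: meval_eq => i; rewrite PE !mxE.
have [_ /eqP[]] := smoothF (scale _ _ Fd Fp).
apply/matrixP => i j; rewrite !mxE.
exact: scale (mderiv_homog i Fd) (dFp i).
Qed.

(** Finiteness of the Gauss map in the form needed: a point over L whose gradient
    is proportional to a vector over K is proportional to a point over K. *)
Lemma gauss_fiber_algebraic (L : fieldType) (iota : {rmorphism K -> L})
    (v : 'I_N.+1 -> L) (c : 'I_N.+1 -> K) (j0 i0 : 'I_N.+1) :
    v i0 != 0 -> mmap iota v F = 0 -> mmap iota v F^`M(j0) != 0 ->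
    (forall i, mmap iota v F^`M(i) = iota (c i) * mmap iota v F^`M(j0)) ->
  exists p, forall i, v i = iota (p i) * v i0.
Proof.
move=> vi0 Fv l0 lc; set l := mmap iota v F^`M(j0) in l0 lc.
have d1 : (0 < d.-1)%N by rewrite -ltnS prednK ltnW // ltnW.
(* d - 1 is the degree of the partial derivatives, so l / v_j^(d-1) is
   invariant under scaling of v. *)
have algebraic j : v j != 0 -> exists a, iota a = l / v j ^+ d.-1.
  move=> vj; set y := l / _.
  have [//|/forallNP noa] := pselect (exists a, iota a = y).
  have yK a : iota a != y by apply/eqP.
  have [m [P [vm Pm PP]]] := place_specialization yK vi0.
  pose u i := v i / v m.
  have uE e q : q \is e.-homog -> mmap iota u q = (v m)^-1 ^+ e * mmap iota v q.
    move=> qe; rewrite -(mmap_homog_scale iota _ _ qe) /u.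
    by congr (mmap _ _ _); apply/funext => i; rewrite mulrC.
  exfalso; apply: (@no_affine_singular_point P m); rewrite ?Pm ?oner_eq0 //.
    by apply: (PP F 0); rewrite (uE _ _ Fd) Fv mulr0 rmorph0 mulr0.
  have P0 : F^`M(j0).@[P] = 0.
    apply: (PP _ ('X_j ^+ d.-1)).
    rewrite (uE _ _ (mderiv_homog j0 Fd)) rmorphXn /= mmapX mmap1U -/l.
    by rewrite exprVn expr_div_n mulrA divfK ?expf_neq0 // mulrC.
  move=> i; have : (F^`M(i) - c i *: F^`M(j0)).@[P] = 0.
    apply: (PP _ 0); rewrite rmorph0 mulr0 (uE d.-1); last first.
      by rewrite rpredB ?rpredZ ?mderiv_homog.
    by rewrite rmorphB /= mmapZ lc subrr mulr0.
  by rewrite mevalB mevalZ P0 mulr0 subr0.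
have /fin_all_exists[p pE] : forall i, exists p, v i = iota p * v i0.
  move=> i; have [->|vi] := eqVneq (v i) 0; first by exists 0; rewrite rmorph0 mul0r.
  have [a aE] := algebraic _ vi0; have [b bE] := algebraic _ vi.
  have [[p pE]|/forallNP nop] := pselect (exists p, iota p = v i / v i0).
    by exists p; rewrite pE divfK.
  have yK p : iota p != v i / v i0 by apply/eqP.
  have b0 : iota b != 0 by rewrite bE mulf_neq0 ?invr_eq0 ?expf_neq0.
  have : 'X^(d.-1) - (a / b)%:P = 0.
    apply: (transcendental_horner_inj yK).
    rewrite rmorphB /= map_polyXn map_polyC /= hornerD hornerN hornerXn hornerC.
    rewrite fmorph_div /= aE bE expr_div_n invf_div [l / _ * _]mulrC mulrA.
    by rewrite divfK // subrr.
  by move/eqP; rewrite -size_poly_eq0 size_XnsubC.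
by exists p.
Qed.

Lemma finite_star_points : finite_set [set P | star_point d F P].
Proof.
apply: contrapT => /infiniteP/card_leP[f].
pose s k := set_val (f (to_setT k)).
have sP k : star_point d F (s k) by apply: set_mem; apply: (valP (f (to_setT k))).
have s_inj : injective s.
  by move=> k k' /val_inj/(inj (f := f)) E; have [] := E (in_setT _) (in_setT _).
have [L [iota [v [vP vE]]]] := generic_point (fun k i => hcoord (s k) 0 i).
have nonvanishing (q : 'I_N.+1 -> {mpoly K[N.+1]}) :
    (forall k, ~ forall i, (q i).@[fun i => hcoord (s k) 0 i] = 0) ->
    exists i, mmap iota v (q i) != 0.
  move=> qs; apply: contrapT => /forallNP q0.
  have [|k _ qk] := vE (codom q) _ 0%N.
    by move=> _ /codomP[i ->]; apply/eqP; rewrite -[_ == _]negbK; apply/negP/q0.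
  by apply: (qs k) => i; apply: qk; apply: codom_f.
have [i0 vi0] : exists i, v i != 0.
  have [k s0|i] := nonvanishing (fun i => 'X_i); last by rewrite mmapX mmap1U; exists i.
  have /eqP[] := hcoord_neq0 (s k); apply/rowP => i; rewrite mxE -(s0 i).
  by rewrite mevalXU.
have [j0 l0] : exists i, mmap iota v F^`M(i) != 0.
  apply: nonvanishing => k s0; have [[_ /eqP grad] _] := sP k.
  by apply: grad; apply/colP => i; rewrite !mxE s0.
have Fv : mmap iota v F = 0 by apply: vP => k; have [[]] := sP k.
have flat i m : mmap iota v (flatness_form F i j0 m) = 0.
  by apply: vP => k; apply: star_point_flatness (sP k).
have /fin_all_exists[c cE] i : exists c, iota c = _ :=
  flat_gauss_constant K0 Fv (flat i) l0.
have [|p pE] := gauss_fiber_algebraic vi0 Fv l0 (c := c).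
  by move=> i; rewrite cE divfK.
(* The equations X_i = p_i X_i0 hold at v, hence at two different terms of the
   sequence, which are then the same point. *)
have on_line m : exists2 k, (m <= k)%N &
    forall i, hcoord (s k) 0 i = p i * hcoord (s k) 0 i0.
  have [|k mk sk] := vE [seq 'X_i - p i *: 'X_i0 | i <- enum 'I_N.+1] _ m.
    by move=> _ /mapP[i _ ->]; rewrite rmorphB /= mmapZ !mmapX !mmap1U pE subrr.
  exists k => // i; apply/eqP; rewrite -subr_eq0; apply/eqP.
  have := sk ('X_i - p i *: 'X_i0); rewrite mevalB mevalZ !mevalXU; apply.
  by apply: map_f; rewrite mem_enum.
have [k _ kP] := on_line 0%N; have [k' kk' k'P] := on_line k.+1.
suff /s_inj E : s k' = s k by rewrite E ltnn in kk'.
have t0 : hcoord (s k) 0 i0 != 0.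
  apply: contraNneq (hcoord_neq0 (s k)) => t0; apply/eqP/rowP => i.
  by rewrite kP t0 mulr0 mxE.
apply: (@proj_eq _ _ _ _ (hcoord (s k') 0 i0 / hcoord (s k) 0 i0)).
by apply/rowP => i; rewrite mxE (kP i) (k'P i) mulrCA divfK.
Qed.
End Finiteness.

Theorem theorem4p2 (R : realType) (N d : nat) (F : {mpoly R[i][N.+1]})
    (hN : (2 <= N)%N) (hd : (3 <= d)%N)
    (hF : hypersurface d F) (hsmooth : smooth_hypersurface F) :
  finite_set [set P : proj_space R[i] N | star_point d F P].
Proof.
by apply: (finite_star_points (Num.Theory.pchar_num _) hd hF.1 hsmooth).
Qed.
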